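(* Let $Y_1,\dots,Y_N\in[C]$ be i.i.d. with $\mathbb{P}(Y_i=a)=\pi_a$, and let $B\in[0,1]^{C\times C}$. Assume that for each $i<j$ $$A_{ij}\mid(Y_i=a,Y_j=b)\sim\mathrm{Bern}(B_{ab}),$$ and that $\{A_{ij}\}_{i<j}$ are independent given $Y=(Y_1,\dots,Y_N)$. Let $\bar p=\mathbb{P}(A_{ij}=1)=\sum_{a,b}\pi_a\pi_bB_{ab}$. Then, for each $i<j$, $$I(A_{ij};Y_i,Y_j)=\sum_{a,b}\pi_a\pi_b\,D_{\mathrm{KL}}\bigl(\mathrm{Bern}(B_{ab})\,\big\|\,\mathrm{Bern}(\bar p)\bigr).$$ In particular, $I(A_{ij};Y_i,Y_j)=0$ if and only if $B_{ab}=\bar p$ for all $(a,b)$ with $\pi_a\pi_b>0$.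
   Context: $[C]=\{1,\dots,C\}$. Given $Y=y$, the edges $A_{ij}$ $(i<j)$ are independent Bernoulli variables with parameters $B_{y_iy_j}$. $D_{\mathrm{KL}}$ is Kullback–Leibler divergence, $\mathrm{Bern}(p)$ the Bernoulli law with success probability $p$, and $I(A_{ij};Y_i,Y_j)$ the mutual information between $A_{ij}$ and the pair $(Y_i,Y_j)$. Terms with $\pi_a\pi_b=0$ are read as $0$. *)

(* Defs.v *)
From mathcomp Require Import all_boot all_order all_algebra.
From mathcomp Require Import all_classical all_reals all_analysis.

Set Implicit Arguments.
Unset Strict Implicit.
Unset Printing Implicit Defensive.

Import Order.TTheory GRing.Theory Num.Theory.

Local Open Scope classical_set_scope.
Local Open Scope ring_scope.

Section divergence.
Local Open Scope ereal_scope.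
Context {R : realType}.

(* p log (p / q) with the conventions 0 log (0 / q) = 0 and
   p log (p / 0) = +oo for p != 0; natural logarithm. A weighted divergence
   0 * kl p q is 0 even when kl p q = +oo, since 0 * +oo = 0 in \bar R. *)
Definition kl_term (p q : R) : \bar R :=
  if p == 0%R then 0 else if q == 0%R then +oo else (p * ln (p / q))%:E.

(* Laws on a finite type are given by their probability mass functions. *)
Definition kl (F : finType) (p q : F -> R) : \bar R :=
  \sum_(x : F) kl_term (p x) (q x).

End divergence.

Section random_variables.
Context {d} {T : measurableType d} {R : realType} (P : probability T R).

(* Measurability into a finite (hence discrete) type; stated on singletons
   because 'I_C, possibly empty, is not a pointedType, so cannot be a
   measurableType. *)
Definition finite_rv (F : finType) (X : T -> F) : Prop :=
  forall x : F, measurable (X @^-1` [set x]).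

Definition law (F : finType) (X : T -> F) (x : F) : R :=
  fine (P (X @^-1` [set x])).

Definition mutual_info (F G : finType) (X : T -> F) (Z : T -> G) : \bar R :=
  kl (law (fun t => (X t, Z t))) (fun xz => law X xz.1 * law Z xz.2).

(* P(D | E); E is the conditioning event, assumed of positive probability by
   users (the quotient is 0 otherwise). *)
Definition cond_prob (E D : set T) : R := fine (P (D `&` E)) / fine (P E).

(* Mutual independence, under the set function Q, of the family of F-valued
   variables X k, k in K; Q is P or a conditional probability. *)
Definition mutually_indep (Q : set T -> R) (I F : finType) (K : {set I})
    (X : I -> T -> F) : Prop :=
  forall (J : {set I}) (x : I -> F), J \subset K ->
    Q (\bigcap_(k in [set` J]) (X k @^-1` [set x k])) =
    \prod_(k in J) Q (X k @^-1` [set x k]).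

End random_variables.

(* Main.v *)
(* The joint law of (A_ij, (Y_i, Y_j)) is the mass pi_a pi_b times the kernel
   Bern(B_ab), so each term of the mutual information carries a common factor
   pi_a pi_b inside and outside the logarithm; cancelling it inside and summing
   over the values of A_ij gives the weighted sum of divergences. This sum of
   nonnegative terms vanishes iff every divergence of positive weight does, and
   p log (p / q) >= p - q, strict for p != q, characterises a zero divergence. *)

Require Import Defs.
From mathcomp Require Import all_boot all_order all_algebra.
From mathcomp Require Import all_classical all_reals all_analysis.
From mathcomp Require Import lra.

Set Implicit Arguments.
Unset Strict Implicit.
Unset Printing Implicit Defensive.

Import Order.TTheory GRing.Theory Num.Theory.

Local Open Scope classical_set_scope.
Local Open Scope ring_scope.

(** For positive [p] and [q] this is [1 + x < expR x] at [x = ln (q / p)], multiplied by [p]. The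
    bound is [p - q] rather than 0 because a single term may be negative, whereas the differences
    [p - q] cancel in the sum over two laws. *)
Lemma kl_term_gt {R : realType} (p q : R) :
  0 <= p -> 0 <= q -> p != q -> ((p - q)%:E < kl_term p q)%E.
Proof.
rewrite /kl_term => p0 q0 pq.
have [pE|pN0] := eqVneq p 0.
  by rewrite lte_fin; move: pq; rewrite pE neq_lt; lra.
have [_|qN0] := eqVneq q 0; first exact: ltry.
have {p0}p0 : 0 < p by rewrite lt0r pN0.
have {q0}q0 : 0 < q by rewrite lt0r qN0.
rewrite lte_fin.
have qp0 : 0 < q / p by rewrite divr_gt0.
have -> : ln (p / q) = - ln (q / p) by rewrite -lnV ?posrE// invf_div.
have ln_neq0 : ln (q / p) != 0.
  rewrite ln_eq0 //; apply: contra pq => /eqP qp.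
  by rewrite -(divfK pN0 q) qp mul1r.
have := expR_gt1Dx ln_neq0; rewrite lnK ?posrE// ltr_pdivlMr//.
by lra.
Qed.

Lemma kl_term_diag {R : realType} (p : R) : kl_term p p = 0%E.
Proof. by rewrite /kl_term; case: eqVneq => // p0; rewrite divff// ln1 mulr0. Qed.

Lemma kl_term_ge {R : realType} (p q : R) :
  0 <= p -> 0 <= q -> ((p - q)%:E <= kl_term p q)%E.
Proof.
move=> p0 q0; have [->|pq] := eqVneq p q; first by rewrite subrr kl_term_diag.
exact/ltW/kl_term_gt.
Qed.

Lemma kl_term_neq_ninfty {R : realType} (p q : R) : kl_term p q != -oo%E.
Proof. by rewrite /kl_term; case: ifP => // _; case: ifP. Qed.

(** The factor [w] cancels in the ratio under the logarithm. The case [w = 0] survives even an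
    infinite divergence, since [0 * +oo = 0]. *)
Lemma kl_termZ {R : realType} (w p q : R) :
  0 <= w -> kl_term (w * p) (w * q) = (w%:E * kl_term p q)%E.
Proof.
rewrite le_eqVlt => /predU1P[<-|w0]; first by rewrite !mul0r kl_term_diag mul0e.
rewrite /kl_term !mulf_eq0 (gt_eqF w0) /=.
case: ifP => _; first by rewrite mule0.
case: ifP => _; first by rewrite gt0_muley.
by rewrite -mulrA -EFinM -mulf_div divff ?gt_eqF// mul1r.
Qed.

Section kl_divergence.
Context {R : realType} {F : finType} (p q : F -> R).
Context (p0 : forall x, 0 <= p x) (q0 : forall x, 0 <= q x).
Context (pq1 : \sum_x p x = \sum_x q x).

(** Gibbs' inequality: the termwise lower bounds [p x - q x] add up to 0 because the total masses
    agree. *)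
Lemma kl_ge0 : (0 <= kl p q)%E.
Proof.
have -> : 0%E = (\sum_x (p x - q x)%:E)%E :> \bar R.
  by rewrite sumEFin sumrB pq1 subrr.
by apply: lee_sum => x _; exact: kl_term_ge.
Qed.

Lemma kl_eq0 : kl p q = 0%E <-> p =1 q.
Proof.
split=> [klpq x|pq]; last by apply: big1 => x _; rewrite pq kl_term_diag.
apply/eqP; apply: contraT => pqx.
suff : (0 < kl p q)%E by rewrite klpq ltxx.
have -> : 0%E = (\sum_x (p x - q x)%:E)%E :> \bar R.
  by rewrite sumEFin sumrB pq1 subrr.
(* The bound is strict at the point [x] where the laws differ and weak elsewhere. Strictness
   survives the addition because the remaining differences have a finite sum. *)
rewrite /kl (bigD1 x)//= [ltRHS](bigD1 x)//=.
apply: lte_leD; [by rewrite sumEFin|exact: kl_term_gt|].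
by apply: lee_sum => y _; exact: kl_term_ge.
Qed.

End kl_divergence.

Section total_probability.
Context {d} {T : measurableType d} {R : realType} (P : probability T R).

Lemma measure_finite_rv (F : finType) (X : T -> F) (D : set T) :
  finite_rv X -> measurable D -> P D = (\sum_x P (D `&` X @^-1` [set x]))%E.
Proof.
move=> mX mD.
rewrite fsbig_seq ?index_enum_uniq// -measure_fin_bigcup//.
- congr (P _); apply/seteqP; split=> [t Dt|t [x _ []]//].
  by exists (X t) => //=; rewrite mem_index_enum.
- by move=> x y _ _ [t [[_ <-] [_ <-]]].
- by move=> x _; exact: measurableI.
Qed.

Lemma lawE (F : finType) (X : T -> F) (x : F) :
  finite_rv X -> P (X @^-1` [set x]) = (law P X x)%:E.
Proof. by move=> mX; rewrite /law fineK// fin_num_measure. Qed.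

Lemma law_ge0 (F : finType) (X : T -> F) (x : F) : 0 <= law P X x.
Proof. by rewrite /law fine_ge0. Qed.

Lemma preimage_pair (F G : Type) (X : T -> F) (Z : T -> G) x z :
  (fun t => (X t, Z t)) @^-1` [set (x, z)] = X @^-1` [set x] `&` Z @^-1` [set z].
Proof. by apply/seteqP; split=> t /= [-> ->]. Qed.

Lemma finite_rv_pair (F G : finType) (X : T -> F) (Z : T -> G) :
  finite_rv X -> finite_rv Z -> finite_rv (fun t => (X t, Z t)).
Proof. by move=> mX mZ [x z]; rewrite preimage_pair; exact: measurableI. Qed.

Lemma sum_law (F : finType) (X : T -> F) :
  finite_rv X -> \sum_x law P X x = 1.
Proof.
move=> mX; apply: EFin_inj; rewrite -sumEFin -(probability_setT P).
rewrite (measure_finite_rv mX)//.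
by apply: eq_bigr => x _; rewrite setTI lawE.
Qed.

Lemma law_marginal (F G : finType) (X : T -> F) (Z : T -> G) x :
  finite_rv X -> finite_rv Z ->
  law P X x = \sum_z law P (fun t => (X t, Z t)) (x, z).
Proof.
move=> mX mZ; apply: EFin_inj; rewrite -lawE// -sumEFin (measure_finite_rv mZ)//.
apply: eq_bigr => z _; rewrite -preimage_pair lawE//.
exact: finite_rv_pair.
Qed.

(* Off the support of [Z], [k] is unconstrained. *)
Lemma mutual_info_kernel (F G : finType) (X : T -> F) (Z : T -> G)
    (k : G -> F -> R) :
  (forall x z, law P (fun t => (X t, Z t)) (x, z) = law P Z z * k z x) ->
  mutual_info P X Z = (\sum_z (law P Z z)%:E * kl (k z) (law P X))%E.
Proof.
move=> XZ; rewrite /mutual_info /kl.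
under [RHS]eq_bigr => z _.
  rewrite fin_num_sume_distrr//; last first.
    (* The weight distributes over the sum if [+oo] and [-oo] never meet, and no term is [-oo]. *)
    move=> x y _ _.
    by rewrite /adde_def !(negbTE (kl_term_neq_ninfty _ _)) !andbF.
  over.
rewrite exchange_big pair_bigA /=; apply: eq_bigr => -[x z] _ /=.
by rewrite XZ [law P X x * _]mulrC kl_termZ// law_ge0.
Qed.

Lemma indep_pair (I F : finType) (X : I -> T -> F) (i j : I) (a b : F) :
  mutually_indep (fun E => fine (P E)) [set: I]%SET X -> i != j ->
  fine (P (X i @^-1` [set a] `&` X j @^-1` [set b])) =
    law P (X i) a * law P (X j) b.
Proof.
(* Mutual independence is used on the subfamily [{i, j}]; since [i != j], the target family takes
   the value [b] at [j]. *)
move=> /(_ [set i; j]%SET (fun k => if k == i then a else b)) indepX ij.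
have := indepX (finset.subsetT _); rewrite big_setU1 ?inE//= big_set1.
rewrite eqxx eq_sym (negbTE ij) => <-; congr (fine (P _)).
apply/seteqP; split=> [t [/= ia jb] k /=|t XE].
  by rewrite !inE => /orP[] /eqP ->; rewrite ?eqxx// eq_sym (negbTE ij).
split.
  by have := XE i; rewrite /= !inE eqxx; apply.
by have := XE j; rewrite /= !inE eqxx orbT eq_sym (negbTE ij); apply.
Qed.

End total_probability.

Lemma finite_rv_mfun d (T : measurableType d) (R : realType)
    (P : probability T R) (X : {RV P >-> bool}) : finite_rv X.
Proof. by move=> e; rewrite -[X in measurable X]setTI; exact: measurable_funP. Qed.

Lemma sum_bernoulli_pmf (R : realType) (p : R) : \sum_e bernoulli_pmf p e = 1.
Proof. by rewrite big_bool /= /bernoulli_pmf addrC subrK. Qed.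

Theorem theorem19 (R : realType) (d : measure_display) (T : measurableType d)
    (P : probability T R) (C N : nat) (prior : 'I_C -> R) (B : 'M[R]_C)
    (Y : 'I_N -> T -> 'I_C) (A : 'I_N -> 'I_N -> {RV P >-> bool})
    (B01 : forall a b, 0 <= B a b <= 1)
    (Y_rv : forall i, finite_rv (Y i))
    (Y_law : forall i a, P (Y i @^-1` [set a]) = (prior a)%:E)
    (Y_indep : mutually_indep (fun E => fine (P E)) [set: 'I_N]%SET Y)
    (A_law : forall (i j : 'I_N) (a b : 'I_C), (i < j)%N ->
       let E := Y i @^-1` [set a] `&` Y j @^-1` [set b] in
       (0 < P E)%E ->
       forall e : bool,
         cond_prob P E (A i j @^-1` [set e]) = bernoulli_pmf (B a b) e)
    (A_indep : forall y : 'I_N -> 'I_C,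
       let E := \bigcap_(k in [set: 'I_N]) (Y k @^-1` [set y k]) in
       (0 < P E)%E ->
       mutually_indep (cond_prob P E)
         [set ij : 'I_N * 'I_N | (ij.1 < ij.2)%N]%SET
         (fun ij => A ij.1 ij.2 : T -> bool)) :
  let pbar := \sum_(a < C) \sum_(b < C) prior a * prior b * B a b in
  forall i j : 'I_N, (i < j)%N ->
  let I_ij := mutual_info P (A i j) (fun t => (Y i t, Y j t)) in
  [/\ P (A i j @^-1` [set true]) = pbar%:E,
      I_ij = (\sum_(a < C) \sum_(b < C) (prior a * prior b)%:E *
               kl (bernoulli_pmf (B a b)) (bernoulli_pmf pbar))%E
    & I_ij = 0%E <->
      (forall a b, 0 < prior a * prior b -> B a b = pbar)].
Proof.
move=> pbar i j ij I_ij.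
pose Yij t := (Y i t, Y j t).
have mYij : finite_rv Yij by exact: finite_rv_pair.
have mA : finite_rv (A i j) by exact: finite_rv_mfun.
have lawY ab : law P Yij ab = prior ab.1 * prior ab.2.
  case: ab => a b; rewrite /law /Yij preimage_pair indep_pair ?neq_ltn ?ij//.
  by rewrite /law !Y_law.
have lawAY e ab : law P (fun t => (A i j t, Yij t)) (e, ab) =
    law P Yij ab * bernoulli_pmf (B ab.1 ab.2) e.
  (* [A_law] says nothing about a null conditioning event, but the joint event lies inside it, so
     both sides vanish. *)
  have [w0|wN0] := eqVneq (law P Yij ab) 0.
    apply/eqP; rewrite w0 mul0r eq_le law_ge0 andbT -w0 /law preimage_pair.
    by rewrite fine_le ?fin_num_measure ?le_measure ?inE//; exact: measurableI.
  case: ab wN0 => a b wN0.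
  rewrite -(A_law i j a b ij); last first.
    by rewrite -preimage_pair lawE// lte_fin lt0r wN0 law_ge0.
  rewrite /cond_prob mulrC /law /Yij !preimage_pair divfK//.
  by rewrite -preimage_pair.
have sumE (f : 'I_C * 'I_C -> \bar R) :
    (\sum_(a < C) \sum_(b < C) f (a, b) = \sum_ab f ab)%E.
  by rewrite pair_bigA; apply: eq_bigr => -[].
have lawA : law P (A i j) = bernoulli_pmf pbar.
  have pmf_sum e : law P (A i j) e =
      \sum_ab law P Yij ab * bernoulli_pmf (B ab.1 ab.2) e.
    by rewrite (law_marginal P e mA mYij); apply: eq_bigr => ab _.
  have lawAtrue : law P (A i j) true = pbar.
    rewrite pmf_sum /pbar pair_bigA.
    by apply: eq_bigr => ab _; rewrite lawY.
  (* The mass at [false] is what total mass 1 leaves. *)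
  apply/funext => -[] //; rewrite /bernoulli_pmf -(sum_law P mA) big_bool /=.
  by rewrite lawAtrue addrAC subrr add0r.
have IE : I_ij = (\sum_(a < C) \sum_(b < C) (prior a * prior b)%:E *
               kl (bernoulli_pmf (B a b)) (bernoulli_pmf pbar))%E.
  rewrite (sumE (fun ab => (prior ab.1 * prior ab.2)%:E *
    kl (bernoulli_pmf (B ab.1 ab.2)) (bernoulli_pmf pbar))%E).
  rewrite /I_ij (mutual_info_kernel lawAY) lawA.
  by apply: eq_bigr => ab _; rewrite lawY.
(* That [pbar] lies in [[0, 1]] is read off from its being the parameter of an actual law; the
   weights below are nonnegative for the same reason. *)
have pbar_ge0 e : 0 <= bernoulli_pmf pbar e by rewrite -lawA law_ge0.
have B_ge0 a b e : 0 <= bernoulli_pmf (B a b) e by exact: bernoulli_pmf_ge0.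
have sum_pmf a b : \sum_e bernoulli_pmf (B a b) e = \sum_e bernoulli_pmf pbar e.
  by rewrite !sum_bernoulli_pmf.
have w_ge0 a b : 0 <= prior a * prior b by rewrite -(lawY (a, b)) law_ge0.
have term_ge0 a b : (0 <= (prior a * prior b)%:E *
    kl (bernoulli_pmf (B a b)) (bernoulli_pmf pbar))%E.
  by rewrite mule_ge0 ?lee_fin// kl_ge0.
split=> //; first by rewrite lawE// lawA.
rewrite IE; split=> [I0 a b ab_gt0|BE].
  (* Equality of the two Bernoulli laws, evaluated at [true], is equality of their parameters. *)
  suff /kl_eq0 - /(_ (B_ge0 a b) pbar_ge0 (sum_pmf a b) true)// :
    kl (bernoulli_pmf (B a b)) (bernoulli_pmf pbar) = 0%E by [].
  have : ((prior a * prior b)%:E *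
      kl (bernoulli_pmf (B a b)) (bernoulli_pmf pbar))%E == 0%E.
    move/eqP: I0; rewrite seq_psume_eq0; last by move=> *; exact: sume_ge0.
    move=> /allP/(_ a); rewrite mem_index_enum => /(_ isT)/=.
    rewrite seq_psume_eq0 // => /allP/(_ b); rewrite mem_index_enum.
    exact.
  by rewrite mule_eq0 eqe gt_eqF//= => /eqP.
apply: big1 => a _; apply: big1 => b _.
(* At weight 0 the entry [B a b] may differ from [pbar]; the product is 0 whatever the
   divergence. *)
have [w0|wN0] := eqVneq (prior a * prior b) 0; first by rewrite w0 mul0e.
have -> : B a b = pbar by apply: BE; rewrite lt0r wN0 w_ge0.
by rewrite (kl_eq0 _ _ _).2 ?mule0.
Qed.
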